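(* Let $\lambda>0$, let $f:[0,\infty)\to[0,\infty)$ be locally Lipschitz continuous and superlinear and subcritical at infinity (as specified in the context), and let $\mathcal{T}_h$ be the grid on the $N$-rectangle $\overline{\Omega}$ described in the context. Let $C>0$ be a constant such that $$\frac{f(s)}{s}>\frac{1}{\lambda h_*}\qquad\text{for all } s>C,$$ and let $u_h:\mathcal{T}_h\to\mathbb{R}$ be a nonnegative grid function satisfying $$-\Delta_h u_h+u_h=0 \quad\text{in } \mathcal{T}_h\cap\Omega,\qquad \nabla_h^* u_h\cdot\widehat n-\lambda f(u_h)=0\quad\text{on }\mathcal{T}_h\cap\widetilde{\partial\Omega}.$$ Then $\displaystyle\max_{x_\alpha\in\mathcal{T}_h\cap(\Omega\cup\widetilde{\partial\Omega})}u_h(x_\alpha)\le C$.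
   Context: Domain and grid: $\Omega=(a_1,b_1)\times\cdots\times(a_N,b_N)\subset\mathbb{R}^N$ is an $N$-rectangle; for $i=1,\dots,N$, $m_i\ge 4$ is an integer and $h_i=\frac{b_i-a_i}{m_i-1}$. For each multi-index $\alpha=(\alpha_1,\dots,\alpha_N)$ with $1\le\alpha_i\le m_i$, set $x_\alpha=(a_1+(\alpha_1-1)h_1,\dots,a_N+(\alpha_N-1)h_N)$; $\mathcal{T}_h$ is the set of all these points. A grid function is a map $\mathcal{T}_h\to\mathbb{R}$. Put $h_*=\min_i h_i$, and let $e_i$ be the canonical basis vectors. $\widetilde{\partial\Omega}$ is $\partial\Omega$ with the points where $\partial\Omega$ is not smooth removed (so each point of $\widetilde{\partial\Omega}$ lies in the relative interior of exactly one face), and $\widehat n$ is the unit outward normal vector. Discrete operators: for a grid function $u_h$ and $x_\alpha\in\mathcal{T}_h\cap\Omega$, $$\Delta_h u_h(x_\alpha)=\sum_{i=1}^N\frac{u_h(x_{\alpha+e_i})-2u_h(x_\alpha)+u_h(x_{\alpha-e_i})}{h_i^2}.$$ For $x_\alpha\in\mathcal{T}_h\cap\widetilde{\partial\Omega}$, $\nabla_h^*u_h(x_\alpha)$ has $i$-th component $\frac{u_h(x_{\alpha+e_i})-u_h(x_\alpha)}{h_i}$ if $\widehat n_i(x_\alpha)<0$, $\frac{u_h(x_\alpha)-u_h(x_{\alpha-e_i})}{h_i}$ if $\widehat n_i(x_\alpha)>0$, and $\frac{u_h(x_{\alpha+e_i})-u_h(x_{\alpha-e_i})}{2h_i}$ if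 $\widehat n_i(x_\alpha)=0$. Thus $\nabla_h^*u_h(x_\alpha)\cdot\widehat n=\frac{u_h(x_\alpha)-u_h(y)}{h_i}$, where $i$ is the direction normal to the face containing $x_\alpha$ and $y\in\mathcal{T}_h\cap\Omega$ is the adjacent grid point in the inward normal direction. Standing assumption on $f$: there are $b>0$ and $p$ with $\lim_{s\to+\infty}\frac{f(s)}{s^p}=b$, where $1<p<\frac{N}{N-2}$ if $N\ge 3$ and $p>1$ if $N\in\{1,2\}$. (Since $p>1$, a constant $C$ as in the claim exists.) *)

(* Defs.v *)
From HB Require Import structures.
From mathcomp Require Import all_boot all_order all_algebra.
From mathcomp Require Import all_classical all_reals all_analysis.

Set Implicit Arguments.
Unset Strict Implicit.
Unset Printing Implicit Defensive.

Import Order.TTheory GRing.Theory Num.Theory.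
Import numFieldNormedType.Exports.

Local Open Scope classical_set_scope.
Local Open Scope ring_scope.

Section Nonlinearity.
Context {R : realType}.

Definition superlinear_subcritical (N : nat) (f : R -> R) : Prop :=
  exists b p : R, [/\ 0 < b, 1 < p,
    (3 <= N)%N -> p < N%:R / (N - 2)%:R
    & f s / s `^ p @[s --> +oo] --> b].

End Nonlinearity.

Section Grid.
Context {R : realType} (N : nat).
Variables (a b : 'rV[R]_N) (m : 'I_N -> nat).

Definition Omega : set 'rV[R]_N :=
  [set x | forall i, a 0 i < x 0 i < b 0 i].

(* The smooth part of the boundary of Omega, i.e. the union of the relative
   interiors of its 2N faces. *)
Definition smooth_boundary : set 'rV[R]_N :=
  [set x | exists i, (x 0 i = a 0 i \/ x 0 i = b 0 i) /\
                     forall j, j != i -> a 0 j < x 0 j < b 0 j].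

(* Meaningful only at points of smooth_boundary. *)
Definition outward_normal (x : 'rV[R]_N) : 'rV[R]_N :=
  \row_i (if x 0 i == a 0 i then -1 else if x 0 i == b 0 i then 1 else 0).

Definition step (i : 'I_N) : R := (b 0 i - a 0 i) / ((m i)%:R - 1).

Definition min_step (N_gt0 : (0 < N)%N) : R :=
  \big[Num.min/step (Ordinal N_gt0)]_(i < N) step i.

Definition is_index (alpha : 'rV[int]_N) : Prop :=
  forall i, 1 <= alpha 0 i <= (m i)%:Z.

Definition node (alpha : 'rV[int]_N) : 'rV[R]_N :=
  \row_i (a 0 i + (alpha 0 i - 1)%:~R * step i).

Definition grid : set 'rV[R]_N := [set node alpha | alpha in is_index].

Definition e_ (i : 'I_N) : 'rV[int]_N := delta_mx 0 i.

(* A grid function is represented by a function on the whole space of which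
   only the values on the grid are ever used: at the nodes where the operators
   below are considered, all the nodes in their stencils belong to the grid. *)
Implicit Type u : 'rV[R]_N -> R.

Definition laplace_h u (alpha : 'rV[int]_N) : R :=
  \sum_(i < N)
    (u (node (alpha + e_ i)) - 2 * u (node alpha) + u (node (alpha - e_ i)))
    / step i ^+ 2.

Definition grad_h u (alpha : 'rV[int]_N) : 'rV[R]_N :=
  \row_i
    (let n_i := outward_normal (node alpha) 0 i in
     if n_i < 0 then (u (node (alpha + e_ i)) - u (node alpha)) / step i
     else if n_i > 0 then (u (node alpha) - u (node (alpha - e_ i))) / step i
     else (u (node (alpha + e_ i)) - u (node (alpha - e_ i))) / (2 * step i)).

End Grid.

Definition dot {R : realType} {N : nat} (v w : 'rV[R]_N) : R :=
  \sum_(i < N) v 0 i * w 0 i.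

Definition is_max {R : realType} {T : Type} (g : T -> R) (A : set T) (M : R)
    : Prop :=
  (g @` A) M /\ ubound (g @` A) M.

(* Main.v *)
Require Import Defs.
From HB Require Import structures.
From mathcomp Require Import all_boot all_order all_algebra.
From mathcomp Require Import all_classical all_reals all_analysis.
From mathcomp Require Import zify lra.

(** The bound is a discrete maximum principle.  There are finitely many grid
    points, so [u] has a maximum [M] over the nodes of the open rectangle and of
    its open faces ([grid_max_exists]); suppose [M > C], hence [M > 0].

    - [M] is not attained at an interior node.  All the stencil points of such a
      node move a single coordinate, hence stay among the nodes over which [M]
      is the maximum; every second difference is then nonpositive, so
      [M = laplace_h u <= 0] ([laplace_h_le0]).

    - [M] is not attained on a face either.  There the boundary condition reads
      [(M - u y) / h_i = lambda * f M] with [y] the inward neighbour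
      ([normal_flux_le]).  Since [u y >= 0], it gives
      [lambda * f M <= M / h_i <= M / h_*], whereas the choice of [C] makes
      [lambda * f M > M / h_*].  Only the sign of [u] at [y] enters, which is
      why the bound on [f s / s] depends on the mesh. *)

Import Order.TTheory GRing.Theory Num.Theory.
Import numFieldNormedType.Exports.

Local Open Scope classical_set_scope.
Local Open Scope ring_scope.

Lemma finite_set_max (d : Order.disp_t) (T : orderType d) (B : set T) :
  finite_set B -> B !=set0 -> exists2 M, B M & ubound B M.
Proof.
case/finite_seqP=> s -> {B}; elim: s => [[x]|x s IHs _]; first by rewrite /= in_nil.
have [s0|/set0P /IHs[M sM Mmax]] := eqVneq [set` s] (@set0 T).
  exists x; first by rewrite /= mem_head.
  move=> y /=; rewrite in_cons => /orP[/eqP->//|ys].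
  by have : [set` s] y by []; rewrite s0.
exists (Order.max x M) => [|y /=].
  by rewrite /= in_cons; case: leP => _; [apply/orP; right|rewrite eqxx].
rewrite in_cons le_max => /orP[/eqP->|ys]; first by rewrite lexx.
by rewrite (Mmax y ys) orbT.
Qed.

Section GridGeometry.
Context {R : realType} (N : nat) (a b : 'rV[R]_N) (m : 'I_N -> nat).
Hypotheses (ab : forall i, a 0 i < b 0 i) (m_ge4 : forall i, (4 <= m i)%N).

Local Notation h := (step a b m).
Local Notation x_ := (node a b m).

(** The nodes at which one of the two equations is imposed. *)
Definition regular_nodes : set 'rV[R]_N :=
  grid a b m `&` (Omega a b `|` smooth_boundary a b).

Lemma m_sub1_gt0 i : 0 < (m i)%:R - 1 :> R.
Proof. by rewrite subr_gt0 ltr1n; apply: leq_trans (m_ge4 i). Qed.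

Lemma step_gt0 i : 0 < h i.
Proof. by rewrite divr_gt0 ?m_sub1_gt0// subr_gt0. Qed.

Lemma node_lt_node i (z : int) alpha :
  (x_ alpha 0 i < a 0 i + (z - 1)%:~R * h i) = (alpha 0 i < z).
Proof. by rewrite mxE ltrD2l ltr_pM2r ?step_gt0// ltr_int ltrD2r. Qed.

Lemma endpoint_a i : a 0 i = a 0 i + (1 - 1)%:~R * h i.
Proof. by rewrite subrr mul0r addr0. Qed.

Lemma endpoint_b i : b 0 i = a 0 i + ((m i)%:Z - 1)%:~R * h i.
Proof.
by rewrite intrD mulrC divfK ?gt_eqF ?m_sub1_gt0// addrC subrK.
Qed.

Lemma node_lt_b i alpha : (x_ alpha 0 i < b 0 i) = (alpha 0 i < (m i)%:Z).
Proof. by rewrite endpoint_b node_lt_node. Qed.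

Lemma node_gt_a i alpha : (a 0 i < x_ alpha 0 i) = (1 < alpha 0 i).
Proof.
by rewrite mxE ltrDl pmulr_lgt0 ?step_gt0// ltr0z subr_gt0.
Qed.

Lemma node_inside i alpha :
  (a 0 i < x_ alpha 0 i < b 0 i) = (1 < alpha 0 i < (m i)%:Z).
Proof. by rewrite node_lt_b node_gt_a. Qed.

(** Moving an interior node along direction [i] can only bring coordinate [i] to
    an end of its interval, so the neighbour reached lies on a single face: this
    is what keeps stencils away from the singular part of the boundary. *)
Lemma regular_nodesP alpha i : is_index m alpha ->
  (forall j, j != i -> a 0 j < x_ alpha 0 j < b 0 j) ->
  regular_nodes (x_ alpha).
Proof.
move=> alphaI inside; split; first by exists alpha.
have [ii|bi] := boolP (a 0 i < x_ alpha 0 i < b 0 i).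
  by left=> j; have [->|/inside] := eqVneq j i.
right; exists i; split=> //; move: bi; rewrite node_inside.
have /andP[ge1 lem] := alphaI i.
rewrite negb_and -!leNgt => /orP[le1|gem].
  left; rewrite mxE (_ : alpha 0 i = 1) -?endpoint_a//.
  by apply/eqP; rewrite eq_le le1.
right; rewrite mxE (_ : alpha 0 i = (m i)%:Z) -?endpoint_b//.
by apply/eqP; rewrite eq_le lem.
Qed.

Lemma node_addZe_off i j alpha (z : int) : j != i ->
  x_ (alpha + z *: e_ i) 0 j = x_ alpha 0 j.
Proof.
by move=> /negbTE ji; rewrite !mxE eqxx ji mulr0 addr0.
Qed.

Lemma is_index_addZe i alpha (z : int) : is_index m alpha ->
  1 <= alpha 0 i + z <= (m i)%:Z -> is_index m (alpha + z *: e_ i).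
Proof.
move=> alphaI zi j; rewrite !mxE eqxx.
by have [->|_] := eqVneq j i; rewrite ?mulr1// mulr0 addr0.
Qed.

Lemma regular_neighbour i alpha (z : int) :
  is_index m alpha -> Omega a b (x_ alpha) -> `|z| <= 1 ->
  regular_nodes (x_ (alpha + z *: e_ i)).
Proof.
move=> alphaI alphaO z1; apply: (@regular_nodesP _ i) => [|j ji].
  by apply: is_index_addZe => //; have := alphaO i; rewrite node_inside; lia.
by rewrite node_addZe_off.
Qed.

(** Multi-indices are unbounded integer vectors, so finiteness comes from
    covering the grid by the image of a finite type of functions. *)
Lemma finite_grid : finite_set (grid a b m).
Proof.
(* One bound for all directions keeps the codomain independent of [i]. *)
pose K := (\max_(i < N) m i).+1.
pose g (k : {ffun 'I_N -> 'I_K}) : 'rV[R]_N := x_ (\row_i (k i : nat)%:Z).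
apply: (@sub_finite_set _ _ (g @` setT)); last first.
  by apply: finite_image; exact: finite_finset.
move=> _ [alpha alphaI <-].
have lt_mK i : (m i < K)%N by rewrite ltnS (leq_bigmax i).
exists [ffun i => inord (absz (alpha 0 i))] => //; congr node.
apply/rowP => i; rewrite mxE ffunE inordK; have := alphaI i; have := lt_mK i.
  by move=> _; lia.
by rewrite -/K; lia.
Qed.

(** The multi-index with all entries [2] is interior, which makes the set of
    values nonempty. *)
Lemma grid_max_exists (N_gt0 : (0 < N)%N) (u : 'rV[R]_N -> R) :
  exists M, is_max u regular_nodes M.
Proof.
have [||M] := @finite_set_max _ R (u @` regular_nodes).
- by apply: finite_image; apply: sub_finite_set finite_grid => x [].
- pose two : 'rV[int]_N := const_mx 2.
  exists (u (x_ two)), (x_ two) => //; apply: (@regular_nodesP _ (Ordinal N_gt0)).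
    by move=> i; rewrite mxE; have := m_ge4 i; lia.
  by move=> i _; rewrite node_inside mxE; have := m_ge4 i; lia.
by exists M.
Qed.

(** The maximum need only be taken over [regular_nodes], where the values of [u]
    are controlled: a stencil centred at an interior node never reaches the
    singular part of the boundary. *)
Lemma laplace_h_le0 (u : 'rV[R]_N -> R) alpha :
  is_index m alpha -> Omega a b (x_ alpha) ->
  ubound (u @` regular_nodes) (u (x_ alpha)) ->
  laplace_h a b m u alpha <= 0.
Proof.
move=> alphaI alphaO umax; apply: sumr_le0 => i _.
rewrite pmulr_lle0 ?invr_gt0 ?exprn_gt0 ?step_gt0//.
have le_u (z : int) : `|z| <= 1 -> u (x_ (alpha + z *: e_ i)) <= u (x_ alpha).
  by move=> z1; apply: umax; exists (x_ (alpha + z *: e_ i)) => //;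
    exact: regular_neighbour.
by have := le_u 1 isT; have := le_u (-1) isT; rewrite scaleN1r scale1r; lra.
Qed.

(** On a face normal to direction [i] the tangential entries of the normal
    vanish and the flux is [(u x - u y) / h i] with [y] the inward neighbour;
    dropping [u y >= 0] gives the bound. *)
Lemma normal_flux_le (u : 'rV[R]_N -> R) alpha :
  (forall x, grid a b m x -> 0 <= u x) ->
  is_index m alpha -> smooth_boundary a b (x_ alpha) ->
  exists i, dot (grad_h a b m u alpha) (outward_normal a b (x_ alpha))
            <= u (x_ alpha) / h i.
Proof.
move=> u_ge0 alphaI [i [face inside]]; exists i.
have u_nb (z : int) : 1 <= alpha 0 i + z <= (m i)%:Z ->
    0 <= u (x_ (alpha + z *: e_ i)).
  move=> zi; apply: u_ge0; exists (alpha + z *: e_ i) => //.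
  exact: is_index_addZe.
have aib := ab i; have mi := m_ge4 i; have alphai := alphaI i.
rewrite /dot (bigD1 i)//= big1 ?addr0 => [|j ji]; last first.
  have /andP[aj jb] := inside j ji.
  by rewrite [outward_normal _ _ _ _ _]mxE (gt_eqF aj) (lt_eqF jb) mulr0.
rewrite [grad_h _ _ _ _ _ _ _]mxE [outward_normal _ _ _ _ _]mxE.
case: face => [xa|xb].
  rewrite xa eqxx /= ltrN10 mulrN1 -mulNr opprB ler_pM2r ?invr_gt0 ?step_gt0//.
  have : x_ alpha 0 i < b 0 i by rewrite xa.
  rewrite node_lt_b => am; have := u_nb 1.
  by rewrite scale1r gerBl; apply; lia.
rewrite xb gt_eqF// eqxx /= ltr10 ltr01 mulr1 ler_pM2r ?invr_gt0 ?step_gt0//.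
have : a 0 i < x_ alpha 0 i by rewrite xb.
rewrite node_gt_a => am; have := u_nb (-1).
by rewrite scaleN1r gerBl; apply; lia.
Qed.

Lemma min_step_gt0 (N_gt0 : (0 < N)%N) : 0 < min_step a b m N_gt0.
Proof. by apply: lt_bigmin => [|i _]; exact: step_gt0. Qed.

Lemma min_step_le (N_gt0 : (0 < N)%N) i : min_step a b m N_gt0 <= h i.
Proof. exact: bigmin_le_cond. Qed.

End GridGeometry.

Theorem theorem3p1 (R : realType) (N : nat) (N_gt0 : (0 < N)%N)
    (a b : 'rV[R]_N) (m : 'I_N -> nat)
    (ab : forall i, a 0 i < b 0 i) (m_ge4 : forall i, (4 <= m i)%N)
    (lambda : R) (lambda_gt0 : 0 < lambda)
    (f : R -> R) (f_ge0 : forall s, 0 <= s -> 0 <= f s)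
    (f_lip : [locally [lipschitz f x | x in [set s : R | 0 <= s]]])
    (f_growth : superlinear_subcritical N f)
    (C : R) (C_gt0 : 0 < C)
    (fC : forall s, C < s -> f s / s > 1 / (lambda * min_step a b m N_gt0))
    (u : 'rV[R]_N -> R) (u_ge0 : forall x, grid a b m x -> 0 <= u x)
    (u_in : forall alpha, is_index m alpha ->
      Omega a b (node a b m alpha) ->
      - laplace_h a b m u alpha + u (node a b m alpha) = 0)
    (u_bd : forall alpha, is_index m alpha ->
      smooth_boundary a b (node a b m alpha) ->
      dot (grad_h a b m u alpha) (outward_normal a b (node a b m alpha))
        - lambda * f (u (node a b m alpha)) = 0) :
  exists2 M, is_max u (grid a b m `&` (Omega a b `|` smooth_boundary a b)) M
           & M <= C.
Proof.
have [M Mmax] := @grid_max_exists R N a b m ab m_ge4 N_gt0 u.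
exists M => //; rewrite leNgt; apply/negP => CM.
have M_gt0 : 0 < M by exact: lt_trans CM.
case: Mmax => [[_ [[alpha alphaI <-] alphaD] uM] Mub].
case: alphaD => [alphaO|alphaB].
  (* Interior: [M = laplace_h u <= 0] contradicts [M > 0]. *)
  have := @laplace_h_le0 R N a b m ab m_ge4 u alpha alphaI alphaO.
  rewrite uM => /(_ Mub); have := u_in _ alphaI alphaO; rewrite uM; lra.
have [i] := @normal_flux_le R N a b m ab m_ge4 u alpha u_ge0 alphaI alphaB.
have /eqP := u_bd _ alphaI alphaB; rewrite subr_eq0 => /eqP ->; rewrite uM.
apply/negP; rewrite -ltNge.
have h_gt0 := @min_step_gt0 R N a b m ab m_ge4 N_gt0.
(* Face: [M / h_i <= M / h_*], and [M / h_* < lambda * f M] by the choice of [C]. *)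
apply: (@le_lt_trans _ _ (M / min_step a b m N_gt0)).
  rewrite ler_pM2l// lef_pV2 ?posrE ?min_step_le//.
  exact: step_gt0.
have := fC _ CM; rewrite ltr_pdivlMr// div1r mulrC ltr_pdivrMr ?mulr_gt0//.
by rewrite ltr_pdivrMr// mulrCA mulrA.
Qed.
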